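(* Let $R$ be a commutative Noetherian ring with identity and let $M$ be a finitely generated unitary $R$-module. Let $n\ge 1$, let $\mathfrak{p}_1,\dots,\mathfrak{p}_n$ be distinct prime ideals in $R$ with $\mathfrak{p}_i\not\subset\mathfrak{p}_j$ for $i\ne j$, and let $r_1,\dots,r_n$ be positive integers. Then $\mathfrak{p}_1^{r_1}\cdots\mathfrak{p}_n^{r_n}$ is the generalized prime ideal factorization of some submodule of $M$ (that is, there is a submodule $N$ of $M$ with $\mathcal{P}_M(N)=\mathfrak{p}_1^{r_1}\cdots\mathfrak{p}_n^{r_n}$) if and only if $$\mathfrak{p}_i\in\mathrm{Supp}\big(\mathfrak{p}_1^{r_1}\cdots\mathfrak{p}_{i-1}^{r_{i-1}}\,\mathfrak{p}_i^{r_i-1}\,\mathfrak{p}_{i+1}^{r_{i+1}}\cdots\mathfrak{p}_n^{r_n}M\big)\quad\text{for every }1\le i\le n.$$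
   Context: Let $R$ be a commutative Noetherian ring with identity and $M$ a finitely generated $R$-module. For submodules $N, K$ of $M$, $(N:K)=\{a\in R: aK\subseteq N\}$. A proper submodule $N$ of a module $K$ is a prime submodule of $K$ if for all $a\in R$, $x\in K$, $ax\in N$ implies $a\in(N:K)$ or $x\in N$; then $\mathfrak{p}=(N:K)$ is a prime ideal and $N$ is called a $\mathfrak{p}$-prime submodule of $K$. For submodules $N\subset K$ of $M$, $K$ is a $\mathfrak{p}$-prime extension of $N$ in $M$ if $N$ is a $\mathfrak{p}$-prime submodule of $K$. It is a maximal $\mathfrak{p}$-prime extension of $N$ in $M$ if $K$ is maximal among the submodules of $M$ that are $\mathfrak{p}$-prime extensions of $N$ in $M$. A maximal $\mathfrak{p}$-prime extension $K$ of $N$ in $M$ is regular if $\mathfrak{p}$ is a maximal element (under inclusion) of $\mathrm{Ass}(M/N)$. For a proper submodule $N$ of $M$, a regular prime extension (RPE) filtration of $M$ over $N$ is a chain $N=M_0\subset M_1\subset\cdots\subset M_k=M$ together with primes $\mathfrak{q}_1,\dots,\mathfrak{q}_k$ such that $M_i$ is a regular $\mathfrak{q}_i$-prime extension of $M_{i-1}$ in $M$ for $1\le i\le k$. It is known that every proper submodule $N$ admits an RPE filtration and that the number of times each prime ideal occurs in it is independent of the filtration. The generalized prime ideal factorization $\mathcal{P}_M(N)$ of a proper submodule $N$ in $M$ is the product $\mathfrak{q}_1\cdots\mathfrak{q}_k$ of the primes occurring in any RPE filtration of $M$ over $N$, regarded as a formal product: the assertion $\mathcal{P}_M(N)=\mathfrak{p}_1\cdots\mathfrak{p}_n$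 means that $N$ is a proper submodule of $M$ and the primes occurring in an RPE filtration of $M$ over $N$ are, counted with multiplicity and up to order, exactly $\mathfrak{p}_1,\dots,\mathfrak{p}_n$ (an exponent $r$ on a prime means that it occurs $r$ times). Inside an expression such as $\mathfrak{p}_1^{r}\mathfrak{p}_2^{s}M$ the product is the usual product of ideals, with $\mathfrak{p}^0=R$. *)

(* Defs.v *)
From HB Require Import structures.
From mathcomp Require Import all_boot all_algebra.
From mathcomp Require Import boolp classical_sets.

Set Implicit Arguments.
Unset Strict Implicit.
Unset Printing Implicit Defensive.

Import GRing.Theory.
Local Open Scope classical_set_scope.
Local Open Scope ring_scope.

(* Submodules and ideals are classical sets. Ideals of R are the submodules of
   the regular module R^o; unlike [idealr_closed], [submodule] allows the unit
   ideal. *)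

Definition submodule (R : comNzRingType) (V : lmodType R) (N : set V) : Prop :=
  GRing.submod_closed [in N].

Definition prime_ideal (R : comNzRingType) (P : set R) : Prop :=
  idealr_closed [in P] /\ prime_idealr_closed [in P].

Definition fin_gen (R : comNzRingType) (V : lmodType R) (N : set V) : Prop :=
  exists s : seq V,
    N = [set x | exists c : nat -> R, x = \sum_(i < size s) c i *: s`_i].

Definition noetherian (R : comNzRingType) : Prop :=
  forall I : set R^o, submodule I -> fin_gen I.

(* I X : the finite sums of products a x with a in I and x in X. *)
Definition ideal_smul (R : comNzRingType) (V : lmodType R)
    (I : set R) (X : set V) : set V :=
  [set x | exists s : seq (R * V),
     (forall u, u \in s -> I u.1 /\ X u.2) /\ x = \sum_(u <- s) u.1 *: u.2].

Definition ideal_mul (R : comNzRingType) (I J : set R) : set R :=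
  @ideal_smul R R^o I J.

Definition ideal_exp (R : comNzRingType) (I : set R) (k : nat) : set R :=
  iter k (ideal_mul I) setT.

Definition colon (R : comNzRingType) (V : lmodType R) (N K : set V) : set R :=
  [set a | forall x, K x -> N (a *: x)].

Definition prime_submodule (R : comNzRingType) (V : lmodType R)
    (N K : set V) : Prop :=
  [/\ submodule N, submodule K, N `<` K &
      forall a x, K x -> N (a *: x) -> colon N K a \/ N x].

Definition prime_ext (R : comNzRingType) (V : lmodType R)
    (P : set R) (N K : set V) : Prop :=
  prime_submodule N K /\ colon N K = P.

Definition max_prime_ext (R : comNzRingType) (V : lmodType R)
    (P : set R) (N K : set V) : Prop :=
  prime_ext P N K /\
  forall L : set V, prime_ext P N L -> K `<=` L -> L = K.

(* The coset x + N, an element of V/N. *)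
Definition mod_coset (R : comNzRingType) (V : lmodType R) (N : set V) (x : V) :
    set V :=
  [set y | N (y - x)].

(* Ass(V/N): the primes that are the annihilator of an element of V/N. *)
Definition ass_quot (R : comNzRingType) (V : lmodType R) (N : set V) :
    set (set R) :=
  [set P | prime_ideal P /\
     exists x : V, P = [set a | mod_coset N (a *: x) = mod_coset N 0]].

Definition regular_prime_ext (R : comNzRingType) (V : lmodType R)
    (P : set R) (N K : set V) : Prop :=
  [/\ max_prime_ext P N K, ass_quot N P &
      forall Q, ass_quot N Q -> P `<=` Q -> Q = P].

(* Only the values F 0, ..., F (size qs) of F matter. *)
Definition rpe_filtration (R : comNzRingType) (V : lmodType R)
    (N : set V) (qs : seq (set R)) : Prop :=
  exists F : nat -> set V,
    [/\ F 0%N = N, F (size qs) = setT &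
        forall i, (i < size qs)%N ->
          regular_prime_ext (nth setT qs i) (F i) (F i.+1)].

(* P_V(N) = product of ps, a formal product being a list up to permutation. *)
Definition gen_prime_factorization (R : comNzRingType) (V : lmodType R)
    (N : set V) (ps : seq (set R)) : Prop :=
  [/\ submodule N, N `<` setT &
      exists qs, rpe_filtration N qs /\ perm_eq qs ps].

(* The fraction x/s of the localization X_P as an equivalence class of pairs:
   x/s = y/t iff u (t x - s y) = 0 for some u outside P. *)
Definition loc_frac (R : comNzRingType) (V : lmodType R) (X : set V) (P : set R)
    (x : V) (s : R) : set (V * R) :=
  [set yt | [/\ X yt.1, ~ P yt.2 &
     exists u, ~ P u /\ u *: (yt.2 *: x - s *: yt.1) = 0]].

Definition localization (R : comNzRingType) (V : lmodType R) (X : set V)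
    (P : set R) : set (set (V * R)) :=
  [set loc_frac X P x s | x in X & s in ~` P].

Definition supp (R : comNzRingType) (V : lmodType R) (X : set V) :
    set (set R) :=
  [set P | prime_ideal P /\ localization X P <> [set loc_frac X P 0 1]].

(* Main.v *)
(* Localization at a prime P is handled through saturations [sat P X] of
   submodules X of M, and p_i lies in the support of the i-th module iff
   p_i^(r_i - 1) M is not contained in [sat p_i 0], since the other p_j are not
   contained in p_i.

   If P is maximal in Ass(M/N), the only maximal P-prime extension of N is
   (N : P). Hence along a filtration N = M_0 < ... < M_k = M, after c steps of
   type p_i one has (N : p_i^c) inside M_t locally at p_i. If p_i^(r_i - 1) M
   vanished at p_i, then M_t would be locally everything just before the last
   step of type p_i, contradicting the strictness of that step.

   Conversely, N is the intersection over j of the contractions to M of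
   p_j^(r_j) M_(p_j). The filtration step of type p_i replaces the current
   i-th component by its quotient by p_i; by incomparability the other
   components are unchanged, and by Nakayama's lemma the i-th one reaches M
   after exactly r_i steps. *)
Require Import Defs.
From mathcomp Require Import all_boot all_algebra.
From mathcomp Require Import boolp classical_sets.

Set Implicit Arguments.
Unset Strict Implicit.
Unset Printing Implicit Defensive.

Import GRing.Theory.
Local Open Scope classical_set_scope.
Local Open Scope ring_scope.

Local Notation ideal I := (@submodule _ (_^o) I).

(** * Closure properties of submodules *)

Section Submodules.
Variables (R : comNzRingType) (V : lmodType R).
Implicit Types (N X Y : set V) (I J : set R).

Lemma submoduleP N :
  submodule N <-> N 0 /\ forall a x y, N x -> N y -> N (a *: x + y).
Proof.
split=> -[N0 NL]; split; rewrite ?in_setE // in N0 *.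
  by move=> a x y Nx Ny; have := NL a x y; rewrite !in_setE; apply.
by move=> a x y; rewrite !in_setE; apply: NL.
Qed.

Lemma submod0 N : submodule N -> N 0.
Proof. by case/submoduleP. Qed.

Lemma submodZ N a x : submodule N -> N x -> N (a *: x).
Proof. by case/submoduleP=> N0 NL Nx; rewrite -[_ *: _]addr0; apply: NL. Qed.

Lemma submodD N x y : submodule N -> N x -> N y -> N (x + y).
Proof.
by case/submoduleP=> N0 NL Nx Ny; rewrite -[x]scale1r; apply: NL.
Qed.

Lemma submodB N x y : submodule N -> N x -> N y -> N (x - y).
Proof.
move=> sN Nx Ny; apply: submodD => //; rewrite -scaleN1r.
exact: submodZ.
Qed.

Lemma submod_sum N (T : eqType) (s : seq T) (F : T -> V) :
  submodule N -> (forall i, i \in s -> N (F i)) -> N (\sum_(i <- s) F i).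
Proof.
move=> sN NF; rewrite big_seq; apply: (big_ind N) => //.
  exact: submod0.
by move=> x y; apply: submodD.
Qed.

Lemma submoduleT : submodule [set: V].
Proof. by apply/submoduleP. Qed.

Lemma submodule0 : submodule [set (0 : V)].
Proof. by apply/submoduleP; split=> // a x y -> ->; rewrite scaler0 addr0. Qed.

End Submodules.

(** * Products of an ideal with a set of module elements *)

Section IdealProduct.
Variables (R : comNzRingType) (V : lmodType R).
Implicit Types (N X Y : set V) (I J : set R).

Lemma ideal_smul_sub I X Y : submodule Y ->
  (forall a x, I a -> X x -> Y (a *: x)) -> ideal_smul I X `<=` Y.
Proof.
move=> sY IXY x [s [sIX ->]]; apply: submod_sum => // u us.
by have [? ?] := sIX u us; apply: IXY.
Qed.

Lemma mem_ideal_smul I X a x : I a -> X x -> ideal_smul I X (a *: x).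
Proof.
move=> Ia Xx; exists [:: (a, x)]; rewrite big_seq1; split=> // u.
by rewrite inE => /eqP ->.
Qed.

Lemma submodule_ideal_smul I X : ideal I -> submodule (ideal_smul I X).
Proof.
move=> sI; apply/submoduleP; split; first by exists [::]; rewrite big_nil.
move=> a x y [s [sIX ->]] [t [tIX ->]].
exists ([seq (a * u.1, u.2) | u <- s] ++ t); split=> [u|].
  rewrite mem_cat => /orP[/mapP[v vs ->]|/tIX//].
  by have [Iv Xv] := sIX v vs; split=> //=; exact: (@submodZ R R^o I a v.1).
rewrite big_cat big_map scaler_sumr; congr (_ + _).
by apply: eq_bigr => u _; rewrite scalerA.
Qed.

End IdealProduct.

(** * Residual submodules, and annihilators modulo a submodule *)

Section Residual.
Variables (R : comNzRingType) (V : lmodType R).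
Implicit Types (N X Y : set V) (I J : set R).

(** The submodule usually written (X : I) in V. Modulo X it consists of the classes killed by I. *)
Definition residual X I : set V := [set x | forall a, I a -> X (a *: x)].

Lemma submodule_residual X I : submodule X -> submodule (residual X I).
Proof.
move=> sX; apply/submoduleP; split=> [a _|a x y Xx Xy b Ib].
  by rewrite scaler0; apply: submod0.
rewrite scalerDr scalerA mulrC -scalerA.
by apply: submodD (Xy _ _) => //; apply: submodZ (Xx _ _).
Qed.

Lemma residual_setT X : submodule X -> residual X setT = X.
Proof.
move=> sX; apply/seteqP; split=> [x /(_ 1 I)|x Xx a _].
  by rewrite scale1r.
exact: submodZ.
Qed.

(** Lets the residual by a power of P be computed one factor P at a time, in step with a
    filtration. *)
Lemma residual_mul X I J : submodule X ->
  residual X (ideal_mul I J) = residual (residual X J) I.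
Proof.
move=> sX; apply/seteqP; split=> x Xx.
  move=> a Ia b Jb; rewrite scalerA mulrC; apply: Xx.
  exact: (@mem_ideal_smul R R^o).
move=> _ [s [sIJ ->]]; rewrite scaler_suml; apply: submod_sum => // u us.
have [Iu Ju] := sIJ u us; rewrite -[u.1 *: u.2]/(u.1 * u.2) mulrC -scalerA.
exact: Xx.
Qed.

Lemma residualS X Y I : X `<=` Y -> residual X I `<=` residual Y I.
Proof. by move=> XY x Xx a Ia; apply/XY/Xx. Qed.

Lemma sub_residual X I : submodule X -> X `<=` residual X I.
Proof. by move=> sX x Xx a _; apply: submodZ. Qed.

Definition ann_mod N (x : V) : set R := [set a | N (a *: x)].

Lemma ideal_ann_mod N x : submodule N -> ideal (ann_mod N x).
Proof.
move=> sN; apply/(@submoduleP R R^o); rewrite /ann_mod /= scale0r.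
split=> [|a b c Nb Nc]; first exact: submod0.
by rewrite scalerDl -scalerA; apply: submodD => //; apply: submodZ.
Qed.

Lemma mod_coset_eq0 N x : submodule N ->
  mod_coset N x = mod_coset N 0 <-> N x.
Proof.
move=> sN; split=> [NE|Nx].
  have : mod_coset N x x by rewrite /mod_coset /= subrr; apply: submod0.
  by rewrite NE /mod_coset /= subr0.
apply/seteqP; rewrite /mod_coset; split=> y /=; rewrite subr0 => Ny.
  by rewrite -(subrK x y); apply: submodD.
exact: submodB.
Qed.

(** Equality of a coset with the zero coset is membership in [N], so associated primes are studied
    without forming the quotient. *)
Lemma ass_quotE N P : submodule N ->
  ass_quot N P <-> prime_ideal P /\ exists x, P = ann_mod N x.
Proof.
move=> sN.
have E x : [set a | mod_coset N (a *: x) = mod_coset N 0] = ann_mod N x.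
  by apply/seteqP; split=> a /mod_coset_eq0; apply.
by split=> -[pP [x Px]]; split=> //; exists x; rewrite Px ?E.
Qed.

End Residual.

(** * Prime ideals, and products and powers of ideals *)

Section Primes.
Variable R : comNzRingType.
Implicit Types (P I J : set R).

Lemma prime_idealP P :
  prime_ideal P <-> [/\ ideal P, ~ P 1 & forall a b, P (a * b) -> P a \/ P b].
Proof.
split=> [[[P0 P1 PL] PM]|[/(@submoduleP R R^o)[P0 PL] P1 PM]].
  rewrite in_setE in P0; split.
  - apply/(@submoduleP R R^o); split=> // a x y Px Py.
    by have := PL a x y; rewrite !in_setE; apply.
  - by move=> P1'; case/negP: P1; apply: mem_set.
  - move=> a b; have := PM a b; rewrite in_setE => PM' /PM'.
    by move=> /orP[]; rewrite in_setE; [left|right].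
split; first split; rewrite ?in_setE //.
- by apply/negP => /set_mem.
- by move=> a x y; rewrite !in_setE; apply: PL.
- move=> a b; rewrite in_setE => /PM[?|?]; apply/orP; [left|right];
  exact/mem_set.
Qed.

Lemma prime_ideal_ideal P : prime_ideal P -> ideal P.
Proof. by case/prime_idealP. Qed.

Lemma prime_ideal1 P : prime_ideal P -> ~ P 1.
Proof. by case/prime_idealP. Qed.

Lemma prime_idealM P a b : prime_ideal P -> ~ P a -> ~ P b -> ~ P (a * b).
Proof. by case/prime_idealP=> _ _ PM Pa Pb /PM[]. Qed.

Lemma prime_idealX P a k : prime_ideal P -> ~ P a -> ~ P (a ^+ k).
Proof.
move=> pP Pa; elim: k => [|k IH]; rewrite ?expr0 ?exprS.
  exact: prime_ideal1.
exact: prime_idealM.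
Qed.

Lemma ideal_mulSl I J : ideal I -> ideal_mul I J `<=` I.
Proof.
move=> sI; apply: (@ideal_smul_sub R R^o) => // a b Ia _.
by rewrite -[a *: b]/(a * b) mulrC; exact: (@submodZ R R^o I b a).
Qed.

Lemma ideal_mulSr I J : ideal J -> ideal_mul I J `<=` J.
Proof.
move=> sJ; apply: (@ideal_smul_sub R R^o) => // a b _.
exact: (@submodZ R R^o).
Qed.

Lemma ideal_mul_closed I J : ideal I -> ideal (ideal_mul I J).
Proof. exact: submodule_ideal_smul. Qed.

Lemma ideal_exp_closed I k : ideal I -> ideal (ideal_exp I k).
Proof.
by move=> sI; case: k => [|k]; [apply: submoduleT | apply: ideal_mul_closed].
Qed.

Lemma ideal_expS I k : ideal_exp I k.+1 = ideal_mul I (ideal_exp I k).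
Proof. by []. Qed.

Lemma ideal_exp_leq I k l : ideal I -> (k <= l)%N ->
  ideal_exp I l `<=` ideal_exp I k.
Proof.
move=> sI /subnK <-; elim: (l - k)%N => // m IH.
rewrite addSn ideal_expS; apply: subset_trans IH.
by apply: ideal_mulSr; apply: ideal_exp_closed.
Qed.

Lemma mem_ideal_exp I a k : I a -> ideal_exp I k (a ^+ k).
Proof.
by move=> Ia; elim: k => // k IH; rewrite exprS; apply: (@mem_ideal_smul R R^o).
Qed.

Lemma mem_big_ideal_mul (T : finType) (E : T -> set R) (b : T -> R) :
  (forall j, E j (b j)) -> (\big[@ideal_mul R/setT]_j E j) (\prod_j b j).
Proof.
move=> Eb; apply: (big_rec2 (fun x I => I x)) => // j x I _ Ix.
exact: (@mem_ideal_smul R R^o).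
Qed.

Lemma big_ideal_mul_sub (T : finType) (E : T -> set R) i :
  (forall j, ideal (E j)) -> \big[@ideal_mul R/setT]_j E j `<=` E i.
Proof.
move=> sE; have : i \in index_enum T by rewrite mem_index_enum.
elim: (index_enum T) => // j s IH; rewrite inE big_cons => /orP[/eqP ->|/IH].
  exact: ideal_mulSl.
apply: subset_trans; apply: ideal_mulSr.
elim/big_rec: _ => [|k I _ sI]; first exact: submoduleT.
exact: ideal_mul_closed.
Qed.

Lemma prime_avoid_prod P (T : finType) (Q : pred T) (b : T -> R) :
  prime_ideal P -> (forall j, Q j -> ~ P (b j)) -> ~ P (\prod_(j | Q j) b j).
Proof.
move=> pP Pb; apply: (big_ind (fun x => ~ P x)) => //.
  exact: prime_ideal1.
by move=> x y; apply: prime_idealM.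
Qed.

Lemma not_subset_ex (T : Type) (A B : set T) : ~ (A `<=` B) ->
  exists2 x, A x & ~ B x.
Proof.
move=> AB; apply: contrapT => nx; apply: AB => x Ax.
by apply: contrapT => Bx; apply: nx; exists x.
Qed.

End Primes.

(** * Localization at a prime and the support *)

(* [sat P X] is the preimage in V of the localization of X at P. *)
Section Saturation.
Variables (R : comNzRingType) (V : lmodType R).
Implicit Types (P I : set R) (X Y : set V).

Definition sat P X : set V := [set x | exists2 u, ~ P u & X (u *: x)].

Lemma submodule_sat P X : prime_ideal P -> submodule X -> submodule (sat P X).
Proof.
move=> pP sX; apply/submoduleP; split.
  exists 1; first exact: prime_ideal1.
  by rewrite scaler0; apply: submod0.
move=> a x y [u Pu Xu] [v Pv Xv]; exists (u * v); first exact: prime_idealM.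
rewrite scalerDr !scalerA; apply: submodD => //.
  by rewrite mulrAC [u * a]mulrC mulrAC -scalerA; apply: submodZ.
by rewrite -scalerA; apply: submodZ.
Qed.

Lemma sub_sat P X : prime_ideal P -> X `<=` sat P X.
Proof.
by move=> pP x Xx; exists 1; rewrite ?scale1r //; apply: prime_ideal1.
Qed.

Lemma satS P X Y : X `<=` Y -> sat P X `<=` sat P Y.
Proof. by move=> XY x [u Pu Xu]; exists u => //; apply: XY. Qed.

Lemma sat_cancel P X u x : prime_ideal P -> ~ P u -> sat P X (u *: x) ->
  sat P X x.
Proof.
move=> pP Pu [v Pv Xv]; exists (v * u); first exact: prime_idealM.
by rewrite -scalerA.
Qed.

Lemma sat_residual_cancel P X I u x : prime_ideal P -> ~ P u ->
  residual (sat P X) I (u *: x) -> residual (sat P X) I x.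
Proof.
move=> pP Pu Xux a Ia; apply: (sat_cancel pP Pu).
by rewrite scalerA mulrC -scalerA; apply: Xux.
Qed.

(** If every element of [X] dies locally, all fractions collapse to 0/1. Conversely, x/1 = 0/1
    provides an element outside [P] that kills x. *)
Lemma suppP X P : prime_ideal P -> submodule X ->
  supp X P <-> ~ (X `<=` sat P [set 0]).
Proof.
move=> pP sX; have P1 := prime_ideal1 pP; have X0 := submod0 sX.
split=> [[_ XP] X0P|XP].
  apply: XP; have frac_eq x s : X x -> loc_frac X P x s = loc_frac X P 0 1.
    move=> Xx; apply/seteqP; split=> -[y t] [/= Xy Pt _]; split=> //=.
      have [u Pu /= uy] := X0P _ Xy; exists u.
      by rewrite scaler0 scale1r sub0r scalerN uy oppr0.
    have [u Pu /= ux] := X0P _ Xx; have [v Pv /= vy] := X0P _ Xy.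
    exists (u * v); split; first exact: prime_idealM.
    rewrite scalerBr [in X in X - _]mulrC -!scalerA.
    rewrite (scalerA u t) [u * t]mulrC -scalerA ux !scaler0.
    by rewrite (scalerA v s) [v * s]mulrC -scalerA vy !scaler0 subrr.
  apply/seteqP; split=> [_ [x Xx [s Ps <-]]|_ ->]; first exact: frac_eq.
  by exists 0 => //; exists 1.
split=> // LE; apply: XP => x Xx.
have : localization X P (loc_frac X P x 1) by exists x => //; exists 1.
rewrite LE => fE; have : loc_frac X P x 1 (x, 1).
  by split=> //; exists 1; rewrite subrr scaler0.
rewrite fE => -[_ _ [u [Pu]]] /=.
rewrite scaler0 scale1r sub0r scalerN => /eqP; rewrite oppr_eq0 => /eqP.
by exists u.
Qed.

End Saturation.

(** * Finite generation *)

Section FiniteGeneration.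
Variables (R : comNzRingType) (V : lmodType R).
Implicit Types (P I : set R) (X Y : set V) (s : seq V).

(** Minimality replaces explicit linear combinations, so that an inclusion of [X] in a submodule is
    tested on [s] alone. *)
Definition generated_by s X : Prop :=
  (forall x, x \in s -> X x) /\
  forall Y, submodule Y -> (forall x, x \in s -> Y x) -> X `<=` Y.

Lemma fin_gen_generated X : fin_gen X -> exists s, generated_by s X.
Proof.
case=> s ->; exists s; split=> [x /(nthP 0)[i ltis <-]|Y sY Ys _ [c ->]].
  exists (fun j => (j == i)%:R).
  rewrite (bigD1 (Ordinal ltis)) //= eqxx scale1r.
  rewrite big1 ?addr0 // => j; rewrite -val_eqE /= => /negbTE ->.
  by rewrite scale0r.
apply: submod_sum => // i _; apply: submodZ (Ys _ _) => //; exact: mem_nth.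
Qed.

End FiniteGeneration.

(** * Nakayama's lemma at a prime, and residuals of saturations *)

Section Nakayama.
Variables (R : comNzRingType) (V : lmodType R).
Implicit Types (P I : set R) (X Y : set V) (s : seq V).

(* [gen_mod I Y s] is I<s> + Y. *)
Fixpoint gen_mod I Y s : set V :=
  if s is x :: s' then [set z | exists2 a, I a & gen_mod I Y s' (z - a *: x)]
  else Y.

Lemma submodule_gen_mod I Y s : ideal I -> submodule Y ->
  submodule (gen_mod I Y s).
Proof.
move=> sI sY; elim: s => //= x s IH; apply/submoduleP; split.
  by exists 0; [apply: submod0 sI | rewrite scale0r subr0; apply: submod0].
move=> c y z [a Ia gy] [b Ib gz]; exists (c * a + b).
  by apply: (submodD sI) => //; apply: (submodZ _ sI).
have -> : c *: y + z - (c * a + b) *: x = c *: (y - a *: x) + (z - b *: x).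
  by rewrite scalerBr scalerA scalerDl opprD addrACA.
by apply: submodD => //; apply: submodZ.
Qed.

Lemma sub_gen_mod I Y s : ideal I -> Y `<=` gen_mod I Y s.
Proof.
move=> sI; elim: s => //= x s IH y Yy; exists 0; first exact: submod0 sI.
by rewrite scale0r subr0; apply: IH.
Qed.

Lemma mem_gen_mod I Y s a x : ideal I -> submodule Y -> I a -> x \in s ->
  gen_mod I Y s (a *: x).
Proof.
move=> sI sY Ia; elim: s => //= y s IH; rewrite inE => /orP[/eqP ->|/IH gx].
  exists a => //; rewrite subrr; exact: sub_gen_mod (submod0 sY).
by exists 0; [apply: submod0 sI | rewrite scale0r subr0].
Qed.

Lemma gen_mod_sub I Y s : submodule Y -> (forall x, x \in s -> Y x) ->
  gen_mod I Y s `<=` Y.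
Proof.
move=> sY; elim: s => [_ //|y s IH Ys z [a _ gz]].
rewrite -(subrK (a *: y) z); apply: submodD => //.
  by apply: IH gz => x xs; apply: Ys; rewrite inE xs orbT.
by apply: submodZ (Ys _ _) => //; apply: mem_head.
Qed.

(* Nakayama's lemma over the local ring R_P, eliminating one generator at a
   time: u x = a x + ... with a in P and u outside P can be solved for x. *)
Lemma nakayama_gen_mod P Y s : prime_ideal P -> submodule Y ->
  (forall u x, ~ P u -> Y (u *: x) -> Y x) ->
  (forall x, x \in s -> sat P (gen_mod P Y s) x) -> forall x, x \in s -> Y x.
Proof.
move=> pP sY Ysat; have sP := prime_ideal_ideal pP.
elim: s => // x s IH Hs.
have sg := submodule_gen_mod s sP sY.
have [u Pu /= [a Pa]] := Hs x (mem_head x s); rewrite -scalerBl => gx.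
have Pua : ~ P (u - a).
  by move=> Pua; apply: Pu; rewrite -(subrK a u); apply: submodD sP Pua Pa.
have Ys : forall y, y \in s -> Y y.
  apply: IH => y ys; have [|v Pv /= [b Pb gy]] := Hs y.
    by rewrite inE ys orbT.
  (* Multiplying v y = b x + g by u - a turns b x into an element of P<s> + Y, so the generator x
     drops out of the relations for [s]. *)
  exists ((u - a) * v); first exact: prime_idealM.
  rewrite -scalerA -(subrK (b *: x) (v *: y)) scalerDr.
  apply: submodD => //; first exact: submodZ.
  by rewrite scalerA mulrC -scalerA; apply: submodZ.
move=> y; rewrite inE => /orP[/eqP ->|/Ys//].
by apply: (Ysat (u - a)) => //; apply: gen_mod_sub gx.
Qed.

(** The elimination of generators is applied with [Y] = [sat P [set 0]], from which factors outside
    [P] can be cancelled; P X lies in P<s> + Y. *)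
Lemma nakayama P X s : prime_ideal P -> generated_by s X ->
  X `<=` sat P (ideal_smul P X) -> X `<=` sat P [set 0].
Proof.
move=> pP [sX gX] XPX; have sP := prime_ideal_ideal pP.
have sS := submodule_sat pP (submodule0 V).
apply: (gX (sat P [set 0])) => //.
apply: (nakayama_gen_mod (P := P)) => // [u x Pu|x xs].
  exact: sat_cancel.
apply: satS (XPX _ (sX _ xs)).
have sg := submodule_gen_mod s sP sS.
apply: ideal_smul_sub => // a y Pa Xy; move: y Xy a Pa.
apply: (gX (residual _ P)) => [|y ys a Pa]; first exact: submodule_residual.
exact: mem_gen_mod.
Qed.

(** Products of generators generate, by fixing one factor at a time. This makes Nakayama's lemma
    available for P^m M. *)
Lemma generated_by_ideal_smul I (t : seq R) X s :
  ideal I -> generated_by (V := R^o) t I -> generated_by s X -> submodule X ->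
  generated_by [seq a *: x | a <- t, x <- s] (ideal_smul I X).
Proof.
move=> sI [tI gI] [sX gX] subX; split=> [_ /allpairsP[[a x] /= [ta xs ->]]|].
  by apply: mem_ideal_smul; [apply: tI | apply: sX].
move=> Y sY Yts; apply: ideal_smul_sub => // a x Ia Xx; move: a Ia.
apply: (gI (ann_mod Y x)) => [|a ta]; first exact: ideal_ann_mod.
suff: X `<=` residual Y [set a] by move/(_ x Xx); apply.
apply: gX => [|y ys _ ->]; first exact: submodule_residual.
by apply: Yts; apply/allpairsP; exists (a, y).
Qed.

(** Each generator of [I] needs its own denominator outside [P]; as there are finitely many, their
    product serves for all of them. *)
Lemma residual_sat P I X (t : seq R) : prime_ideal P -> submodule X ->
  generated_by (V := R^o) t I ->
  residual (sat P X) I `<=` sat P (residual X I).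
Proof.
move=> pP sX [tI gI] x Xx.
suff [u Pu Xu] : exists2 u, ~ P u & forall a, a \in t -> X (a *: (u *: x)).
  exists u => //; apply: (gI (ann_mod X (u *: x))) => //; exact: ideal_ann_mod.
elim: t tI {gI} => [|a t IH] tI; first by exists 1 => //; apply: prime_ideal1.
have [|u Pu Xu] := IH; first by move=> b bt; apply: tI; rewrite inE bt orbT.
have [v Pv Xv] := Xx a (tI a (mem_head _ _)).
exists (u * v) => [|b]; first exact: prime_idealM.
rewrite inE => /orP[/eqP ->|bt].
  by rewrite scalerA mulrC -!scalerA; apply: submodZ.
rewrite [u * v]mulrC -scalerA scalerA mulrC -scalerA.
by apply: submodZ (Xu _ _).
Qed.

End Nakayama.

(** * Existence of associated primes, and regular extensions as residuals *)

Section Noetherian.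
Variables (R : comNzRingType) (V : lmodType R).
Hypothesis hR : noetherian R.
Implicit Types (P I : set R) (N K : set V).

(** The union of a nonempty chain is a finitely generated ideal; by totality one member contains all
    its generators and so equals the union. Zorn's lemma then applies. *)
Lemma noetherian_max (F : set (set R)) I : (forall J, F J -> ideal J) -> F I ->
  exists2 J, F J & forall K : set R, F K -> J `<=` K -> K = J.
Proof.
move=> sF FI.
(* The empty set is adjoined to the family because it is the union of the empty chain. *)
have [C Ctot|J [FJ maxJ]] := @Zorn_bigcup R (fun J => J = set0 \/ F J).
  move=> totC; have [C0|] := pselect (forall X, C X -> X = set0).
    left; apply/seteqP; split=> // x [X CX Xx].
    by rewrite -(C0 X CX).
  move=> /existsNP[X0 /not_implyP[CX0 X0n]]; right.
  have FX0 : F X0 by case: (Ctot _ CX0).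
  have FC X x : C X -> X x -> F X.
    by move=> CX Xx; case: (Ctot _ CX) Xx => // ->.
  set U := \bigcup_(X in C) X.
  have sU : ideal U.
    apply/(@submoduleP R R^o); split.
      by exists X0 => //; apply: submod0 (sF _ FX0).
    move=> a x y [X CX Xx] [Y CY Yy].
    have [XY|YX] := totC _ _ CX CY.
      exists Y => //; have sY := sF _ (FC _ _ CY Yy).
      by apply: (submodD sY) => //; apply: (submodZ _ sY); apply: XY.
    exists X => //; have sX := sF _ (FC _ _ CX Xx).
    by apply: (submodD sX); [apply: (submodZ _ sX)|apply: YX].
  have [s [sUs gU]] := fin_gen_generated (hR sU).
  suff [Z [CZ FZ Zs]] : exists Z, [/\ C Z, F Z & forall x, x \in s -> Z x].
    suff -> : U = Z by [].
    apply/seteqP; split=> [|x Zx]; last by exists Z.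
    by apply: gU => //; apply: sF.
  elim: s sUs {gU} => [|x s IH] sUs; first by exists X0.
  have [|Z [CZ FZ Zs]] := IH.
    by move=> y ys; apply: sUs; rewrite inE ys orbT.
  have [X CX Xx] := sUs x (mem_head _ _).
  have [XZ|ZX] := totC _ _ CX CZ.
    by exists Z; split=> // y; rewrite inE => /orP[/eqP ->|/Zs//]; apply: XZ.
  exists X; split=> //; first exact: FC Xx.
  by move=> y; rewrite inE => /orP[/eqP ->//|/Zs/ZX].
(* The adjoined empty set is not maximal, since the ideal [I] contains 0. *)
have {}FJ : F J.
  case: FJ => // J0; case: (maxJ I); last by right.
  rewrite J0 properEneq; split=> //; apply/eqP => I0.
  by have := submod0 (sF _ FI); rewrite -I0.
exists J => // K FK JK; apply: contrapT => KJ; apply: (maxJ K); last by right.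
by rewrite properEneq; split=> //; apply/eqP => /esym.
Qed.

(** A maximal member among the annihilators of elements outside [N] that contain [ann_mod N x] is
    prime. *)
Lemma exists_ass_quot N x : submodule N -> ~ N x ->
  exists2 Q, ass_quot N Q & ann_mod N x `<=` Q.
Proof.
move=> sN Nx.
pose F := [set I | ann_mod N x `<=` I /\ exists2 y, ~ N y & I = ann_mod N y].
have [||Q [xQ [y Ny Qy]] maxQ] := @noetherian_max F (ann_mod N x).
- by move=> _ [_ [y _ ->]]; apply: ideal_ann_mod.
- by split=> //; exists x.
exists Q => //; apply/ass_quotE => //; split; last by exists y.
apply/prime_idealP; split; rewrite {1}Qy; first exact: ideal_ann_mod.
  by rewrite /ann_mod /= scale1r.
move=> a b; rewrite /ann_mod /= => Nab.
have [Nby|Nby] := pselect (N (b *: y)); first by right; rewrite Qy.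
(* The annihilator of b y contains [Q], hence equals it by maximality, and a belongs to it. *)
left; suff <- : ann_mod N (b *: y) = Q by rewrite /ann_mod /= scalerA.
have Qb : Q `<=` ann_mod N (b *: y).
  rewrite Qy /ann_mod => c /= Nc; rewrite scalerA mulrC -scalerA.
  exact: submodZ.
apply: maxQ => //; split; first exact: subset_trans Qb.
by exists (b *: y).
Qed.

(* An element a outside P killing a nonzero element of (N : P)/N would put
   P + (a) inside an associated prime strictly larger than P. *)
Lemma regular_prime_ext_residual P N K :
  regular_prime_ext P N K -> residual N P `<=` K.
Proof.
move=> [[[[sN sK [NK KN] _] colP] maxK] assP maxP].
have [pP _] := (ass_quotE P sN).1 assP.
have KL : K `<=` residual N P by move=> x Kx a; rewrite -colP; apply.
(* Maximality of [K] reduces the claim to (N : P) being itself a [P]-prime extension of [N]. *)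
rewrite -(maxK (residual N P)) //; split; first split=> //.
- exact: submodule_residual.
- split; first exact: sub_residual.
  by move=> LN; apply: KN; apply: subset_trans LN.
- move=> a x Lx Nax; have [Nx|Nx] := pselect (N x); [by right|left].
  have [Q assQ annQ] := exists_ass_quot sN Nx.
  move=> y Ly; apply: Ly; rewrite -(maxP Q) //; first exact: annQ.
  by move=> b Pb; apply: annQ; apply: Lx.
apply/seteqP; split=> [a cola|a Pa x Lx]; last exact: Lx.
by rewrite -colP => x Kx; apply: cola; apply: KL.
Qed.

End Noetherian.

(** * Counting steps along a filtration, and building a single step *)

Section Factorization.
Variables (R : comNzRingType) (M : lmodType R).
Hypothesis hR : noetherian R.

(** The position found is that of the last occurrence; [take t s] stops just before it and so misses
    exactly one copy of [x]. *)
Lemma last_occurrence (T : eqType) (x0 x : T) (s : seq T) : x \in s ->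
  exists t, [/\ (t < size s)%N, nth x0 s t = x &
    count_mem x (take t s) = (count_mem x s).-1].
Proof.
elim/last_ind: s => // s y IH; rewrite mem_rcons inE size_rcons.
have [<- _|xy /= /IH [t [ts tx tc]]] := eqVneq x y.
  exists (size s); split; rewrite ?nth_rcons ?ltnn ?eqxx //.
  by rewrite -cats1 take_size_cat // count_cat /= eqxx !addn0 addn1.
exists t; split; first exact: ltnW.
  by rewrite nth_rcons ts.
rewrite -cats1 takel_cat; last exact: ltnW.
by rewrite count_cat /= [y == x]eq_sym (negbTE xy) !addn0.
Qed.

Lemma count_take_nth (T : eqType) (x0 x : T) (s : seq T) t : (t < size s)%N ->
  count_mem x (take t.+1 s) = (count_mem x (take t s) + (nth x0 s t == x))%N.
Proof. by move=> ts; rewrite (take_nth x0) // -cats1 count_cat /= addn0. Qed.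

(** Induction on t: a step of type [P] absorbs the residual by [P], which passes through the
    saturation, and any other step only enlarges [F t]. *)
Lemma rpe_residual_sub P N qs F : prime_ideal P -> submodule N -> F 0%N = N ->
  (forall t, (t < size qs)%N ->
     regular_prime_ext (V := M) (nth setT qs t) (F t) (F t.+1)) ->
  forall t, (t <= size qs)%N ->
  residual (sat P N) (ideal_exp P (count_mem P (take t qs))) `<=` sat P (F t).
Proof.
move=> pP sN F0 FS; have sS := submodule_sat pP sN.
elim=> [_|t IH ts]; first by rewrite take0 F0 residual_setT.
have IHt := IH (ltnW ts); have Rt := FS t ts.
have [[[[sFt _ [FtFS _] _] _] _] _ _] := Rt.
rewrite (count_take_nth setT) //; have [EP|_] := eqVneq (nth setT qs t) P.
  have [s gs] := fin_gen_generated (hR (prime_ideal_ideal pP)).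
  rewrite EP in Rt; rewrite addn1 ideal_expS residual_mul //.
  apply: subset_trans (residualS IHt) _.
  apply: subset_trans (residual_sat pP sFt gs) _.
  by apply: satS; apply: (regular_prime_ext_residual hR).
by rewrite addn0; apply: subset_trans IHt (satS FtFS).
Qed.

Lemma factorization_residual N ps P : prime_ideal P -> P \in ps ->
  gen_prime_factorization (V := M) N ps ->
  ~ (residual (sat P N) (ideal_exp P (count_mem P ps).-1) = setT).
Proof.
move=> pP Pps [sN _ [qs [[F [F0 _ FS]] qsps]]] resT.
have Pqs : P \in qs by rewrite (perm_mem qsps).
have [t [ts tP tc]] := last_occurrence setT Pqs.
have FT : setT `<=` sat P (F t).
  rewrite -resT -(permP qsps) -tc.
  exact: (rpe_residual_sub pP sN F0 FS (ltnW ts)).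
have := FS t ts; rewrite tP => -[[[[_ _ [_ FSF] primF] colF] _] _ _].
(* Some u outside [P] sends x into [F t]; as [P] is the colon ideal of this prime extension, x is
   already in [F t], so the step is not strict. *)
apply: FSF => x Fx; have [u Pu Fux] := FT x I.
by have [|] := primF u x Fx Fux; rewrite ?colF.
Qed.

(** Since elements outside [p j] cancel modulo [A j], incomparability keeps an extension of type
    [p i] from enlarging any component other than the i-th. *)
Lemma regular_prime_ext_bigcap (J : eqType) (p : J -> set R)
    (A A' : J -> set M) (i : J) :
  (forall j, prime_ideal (p j)) ->
  (forall j k, j != k -> ~ (p j `<=` p k)) ->
  (forall j, submodule (A j)) ->
  (forall j u x, ~ p j u -> A j (u *: x) -> A j x) ->
  A' i = residual (A i) (p i) -> (forall j, j != i -> A' j = A j) ->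
  (exists2 y, A' i y & ~ A i y) ->
  (exists2 u, ~ p i u & forall j y, j != i -> A j (u *: y)) ->
  regular_prime_ext (p i) (\bigcap_j A j) (\bigcap_j A' j).
Proof.
move=> pP incomp sA satA A'i A'j [y A'y Ay] [u pu Au].
have sB : submodule (\bigcap_j A j).
  apply/submoduleP; split=> [j _|a x z Ax Az j _]; first exact: submod0.
  by apply: submodD (Az _ _) => //; apply: submodZ (Ax _ _).
have sA' j : submodule (A' j).
  have [->|/A'j ->] := eqVneq j i; last exact: sA.
  by rewrite A'i; apply: submodule_residual.
have sB' : submodule (\bigcap_j A' j).
  apply/submoduleP; split=> [j _|a x z Ax Az j _]; first exact: submod0.
  by apply: submodD (Az _ _) => //; apply: submodZ (Ax _ _).
have AA' j : A j `<=` A' j.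
  have [->|/A'j ->//] := eqVneq j i.
  by rewrite A'i; apply: sub_residual.
have BB' : \bigcap_j A j `<=` \bigcap_j A' j.
  by move=> x Ax j _; apply/AA'/Ax.
have pB' a x : p i a -> (\bigcap_j A' j) x -> (\bigcap_j A j) (a *: x).
  move=> pa A'x j _; have := A'x j I; have [->|/A'j ->] := eqVneq j i.
    by rewrite A'i; apply.
  exact: submodZ.
(* The factor u moves y into the other components, while u y stays outside [A i]. So u y shows
   strictness and has annihilator exactly [p i]. *)
have B'uy : (\bigcap_j A' j) (u *: y).
  move=> j _; have [->|ji] := eqVneq j i; first exact: submodZ.
  by rewrite A'j //; apply: Au.
have Buy a : ~ p i a -> ~ (\bigcap_j A j) (a *: (u *: y)).
  move=> pa /(_ i I) /(satA _ _ _ pa) /(satA _ _ _ pu).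
  exact: Ay.
have primB a x : (\bigcap_j A' j) x -> (\bigcap_j A j) (a *: x) ->
    p i a \/ (\bigcap_j A j) x.
  move=> B'x Bax; have [pa|pa] := pselect (p i a); [by left|right=> j _].
  have [->|ji] := eqVneq j i; last by rewrite -A'j //; apply: B'x.
  by apply: satA pa _; apply: Bax.
have colB : colon (\bigcap_j A j) (\bigcap_j A' j) = p i.
  apply/seteqP; split=> [a cola|a pa x]; last exact: pB'.
  by apply: contrapT => pa; apply: (Buy a pa); apply: cola.
have Buy1 : ~ (\bigcap_j A j) (u *: y).
  by have := Buy 1 (prime_ideal1 (pP i)); rewrite scale1r.
split; first split.
- split=> //; split=> //.
    by split=> // /(_ _ B'uy).
  by move=> a x; rewrite colB; apply: primB.
(* In any [p i]-prime extension L, an element of [p i] outside [p j] sends L into [A j] and can be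
   cancelled there. *)
- move=> L [[_ sL _ _] colL] B'L; apply/seteqP; split=> // x Lx j _.
  have BpL a : p i a -> A j (a *: x) by rewrite -colL => /(_ x Lx) /(_ j I).
  have [ji|ji] := eqVneq j i; first by subst j; rewrite A'i => a; apply: BpL.
  have [|a pa pja] := @not_subset_ex R (p i) (p j).
    by apply: incomp; rewrite eq_sym.
  by rewrite A'j //; apply: satA pja (BpL a pa).
- apply/ass_quotE => //; split=> //; exists (u *: y).
  apply/seteqP; split=> [a pa|a Ba]; first exact: pB'.
  by apply: contrapT => /Buy.
(* If [Q] is the annihilator of x and x is outside [A j], then [Q] lies in [p j]; with [p i] inside
   [Q], incomparability forces j = i. *)
move=> Q /(ass_quotE _ sB) [pQ [x Qx]] pQi.
have : ~ (\bigcap_j A j) x.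
  by have := prime_ideal1 pQ; rewrite Qx /ann_mod /= scale1r.
move=> /existsNP[j /not_implyP[_ Ajx]].
have Qpj : Q `<=` p j.
  move=> a; rewrite Qx => /(_ j I) Aax.
  by apply: contrapT => pja; apply: Ajx; apply: satA pja Aax.
have [ji|ji] := eqVneq j i.
  by apply/seteqP; split=> //; rewrite -ji.
case: (incomp i j); first by rewrite eq_sym.
exact: subset_trans Qpj.
Qed.

(** Locally at [p i] the product ideal is just the i-th power: u is the product over j != i of
    [k j]-th powers of elements of [p j] outside [p i]. *)
Lemma separating_element n (p : 'I_n -> set R) (k : 'I_n -> nat) i :
  (forall j, prime_ideal (p j)) ->
  (forall j l, j != l -> ~ (p j `<=` p l)) ->
  exists2 u, ~ p i u & forall b, ideal_exp (p i) (k i) b ->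
    (\big[@ideal_mul R/setT]_(j < n) ideal_exp (p j) (k j)) (b * u).
Proof.
move=> pP incomp.
have /choice[b bP] : forall j, exists b, j != i -> p j b /\ ~ p i b.
  move=> j; have [_|ji] := eqVneq j i; first by exists 0.
  have [b ? ?] := not_subset_ex (incomp j i ji).
  by exists b.
exists (\prod_(j | j != i) b j ^+ k j) => [|a pa].
  by apply: prime_avoid_prod => // j /bP[_]; apply: prime_idealX.
pose c j := if j == i then a else b j ^+ k j.
suff -> : a * \prod_(j | j != i) b j ^+ k j = \prod_j c j.
  apply: mem_big_ideal_mul => j; rewrite /c.
  have [->//|/bP[pb _]] := eqVneq j i.
  exact: mem_ideal_exp.
rewrite [RHS](bigD1 i) //= /c eqxx; congr (_ * _).
by apply: eq_bigr => j /negbTE ->.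
Qed.

(** * The chain of residuals of P^r M at P *)

Hypothesis hM : fin_gen [set: M].

(* [power_residual P r m] is the contraction to M of the submodule
   (P^r M_P : P^m) of M_P. *)
Definition power_residual (P : set R) (r m : nat) : set M :=
  residual (sat P (ideal_smul (ideal_exp P r) setT)) (ideal_exp P m).

Section PowerResidual.
Variables (P : set R) (r : nat).
Hypothesis pP : prime_ideal P.

Let expP k : ideal (ideal_exp P k).
Proof. exact/ideal_exp_closed/prime_ideal_ideal. Qed.

Let sub_satP : submodule (sat P (ideal_smul (ideal_exp P r) [set: M])).
Proof. exact/submodule_sat/submodule_ideal_smul. Qed.

Lemma submodule_power_residual m : submodule (power_residual P r m).
Proof. exact: submodule_residual. Qed.

Lemma power_residualS m :
  power_residual P r m.+1 = residual (power_residual P r m) P.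
Proof. by rewrite /power_residual ideal_expS residual_mul. Qed.

Lemma power_residual_absorb m a x : ideal_exp P r a ->
  power_residual P r m (a *: x).
Proof.
move=> Pa; apply: sub_residual => //; apply: sub_sat => //.
exact: mem_ideal_smul.
Qed.

Lemma power_residual_setT m : (r <= m)%N -> power_residual P r m = setT.
Proof.
move=> rm; apply/seteqP; split=> // x _ a Pa; apply: sub_sat => //.
apply: mem_ideal_smul => //.
by apply: ideal_exp_leq rm _ Pa; apply: prime_ideal_ideal.
Qed.

(** Otherwise P^m M lies locally in P^r M, hence in P(P^m M) as m < r. Nakayama's lemma makes P^m M
    vanish at [P], and with it P^(r-1) M. *)
Lemma power_residual_proper m :
  ~ (ideal_smul (ideal_exp P r.-1) [set: M] `<=` sat P [set 0]) ->
  (m < r)%N -> power_residual P r m <> setT.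
Proof.
move=> nsupp mr ET; apply: nsupp; have sP := prime_ideal_ideal pP.
have mulS k l : (k <= l)%N -> ideal_smul (ideal_exp P l) [set: M] `<=`
    ideal_smul (ideal_exp P k) [set: M].
  move=> kl; apply: ideal_smul_sub; first exact: submodule_ideal_smul.
  by move=> a x /(ideal_exp_leq sP kl) Pa _; apply: mem_ideal_smul.
have mr1 : (m <= r.-1)%N by rewrite -ltnS prednK // (leq_ltn_trans _ mr).
apply: subset_trans (mulS _ _ mr1) _.
have [s gs] := fin_gen_generated hM.
have [t gt] := fin_gen_generated (hR (expP m)).
have gts := generated_by_ideal_smul (expP m) gt gs (submoduleT M).
apply: (nakayama pP gts); apply: ideal_smul_sub.
  exact/submodule_sat/submodule_ideal_smul.
move=> a x Pa _; have : power_residual P r m x by rewrite ET.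
move=> /(_ a Pa); apply: satS; apply: subset_trans (mulS _ _ mr) _.
apply: ideal_smul_sub; first exact: submodule_ideal_smul.
move=> b y Pb _.
set PX := ideal_smul P _; suff: ideal_exp P m.+1 `<=` ann_mod PX y by apply.
apply: (@ideal_smul_sub R R^o P (ideal_exp P m)).
  exact/ideal_ann_mod/submodule_ideal_smul.
move=> c d Pc Pd; rewrite /ann_mod /= -scalerA.
by apply/mem_ideal_smul/mem_ideal_smul.
Qed.

End PowerResidual.

(** Each term is the residual of the previous one by [P], so a chain that pauses at m is constant
    from there on; but it reaches M at index [r], against properness at m. *)
Lemma power_residual_strict P r m : prime_ideal P ->
  ~ (ideal_smul (ideal_exp P r.-1) [set: M] `<=` sat P [set 0]) ->
  (m < r)%N ->
  exists2 y, power_residual P r m.+1 y & ~ power_residual P r m y.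
Proof.
move=> pP nsupp mr; apply: not_subset_ex => stat.
have sub_m k : power_residual P r (k + m) `<=` power_residual P r m.
  elim: k => // k IH x; rewrite addSn (power_residualS _ pP) => /(residualS IH).
  by rewrite -(power_residualS _ pP) => /stat.
apply: (power_residual_proper pP nsupp mr); apply/seteqP; split=> //.
rewrite -(power_residual_setT pP (leqnn r)).
by have := sub_m (r - m)%N; rewrite subnK // ltnW.
Qed.

End Factorization.

(** * Multiplicities of the primes, and the criterion for a factorization *)

Lemma count_flatten_nseq (T : eqType) n (p : 'I_n -> T) (r : 'I_n -> nat) i :
  injective p ->
  count_mem (p i) (flatten [seq nseq (r j) (p j) | j : 'I_n]) = r i.
Proof.
move=> injp; rewrite count_flatten -map_comp sumnE big_map big_enum /=.
rewrite (bigD1 i) //= count_nseq /= eqxx mul1n big1 ?addn0 // => j ji.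
by rewrite count_nseq /= (inj_eq injp) (negbTE ji).
Qed.

Theorem corollary2p8 (R : comNzRingType) (M : lmodType R)
    (hR : noetherian R) (hM : fin_gen [set: M])
    (n : nat) (hn : (1 <= n)%N)
    (p : 'I_n -> set R) (r : 'I_n -> nat)
    (p_prime : forall i, prime_ideal (p i))
    (p_distinct : injective p)
    (p_incomparable : forall i j, i != j -> ~ (p i `<=` p j))
    (r_gt0 : forall i, (0 < r i)%N) :
  (exists N : set M,
     gen_prime_factorization N (flatten [seq nseq (r i) (p i) | i : 'I_n]))
  <->
  (forall i : 'I_n,
     supp (ideal_smul
             (\big[@ideal_mul R/setT]_(j < n)
                ideal_exp (p j) (if j == i then (r j).-1 else r j))
             [set: M])
          (p i)).
Proof.
have sexp j k : ideal (ideal_exp (p j) k).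
  exact/ideal_exp_closed/prime_ideal_ideal.
have sbig k : ideal (\big[@ideal_mul R/setT]_(j < n) ideal_exp (p j) (k j)).
  elim/big_rec: _ => [|j I _ _]; first exact: submoduleT.
  exact: ideal_mul_closed.
have cnt i := count_flatten_nseq r i p_distinct.
set qs := flatten _ in cnt *.
split=> [[N facN] i|suppM].
  apply/suppP => //; first exact/submodule_ideal_smul/sbig.
  move=> JM0; have sN : submodule N by case: facN.
  have pqs : p i \in qs by rewrite -has_pred1 has_count cnt.
  apply: (factorization_residual hR (p_prime i) pqs facN).
  apply/seteqP; split=> // x _ b; rewrite cnt => pb.
  pose k j := if j == i then (r j).-1 else r j.
  (* u carries the power [(r i).-1] of [p i] into the whole product, so the assumed local vanishing
     applies to u b x. *)
  have [u pu Ju] := separating_element k i p_prime p_incomparable.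
  apply: (sat_cancel (p_prime i) pu).
  suff: sat (p i) [set 0] (u *: (b *: x)).
    by apply: satS => _ ->; apply: submod0.
  apply: JM0; rewrite scalerA mulrC; apply: mem_ideal_smul => //.
  by apply: Ju; rewrite /k eqxx.
(* The product ideal is contained in its i-th factor, so non-vanishing at [p i] passes to that
   factor. *)
have nsupp i : ~ (ideal_smul (ideal_exp (p i) (r i).-1) [set: M]
                  `<=` sat (p i) [set 0]).
  have /suppP nJ := suppM i; move=> pM0; apply: nJ => //.
    exact/submodule_ideal_smul/sbig.
  apply: subset_trans pM0; apply: ideal_smul_sub.
    exact: submodule_ideal_smul.
  move=> a x Ja _; apply: mem_ideal_smul => //.
  pose E j := ideal_exp (p j) (if j == i then (r j).-1 else r j).
  have := @big_ideal_mul_sub R _ E i (fun j => sexp _ _) a Ja.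
  by rewrite /E eqxx.
(* [c t j] counts the steps of type [p j] among the first t, and [A t j] is the j-th component at
   time t. The submodule sought is [F 0]. *)
pose c t j := count_mem (p j) (take t qs).
pose A t j := power_residual (p j) (r j) (c t j) : set M.
have sA t j : submodule (A t j) by apply: submodule_power_residual.
pose F t := \bigcap_j A t j.
have sF t : submodule (F t).
  apply/submoduleP; split=> [j _|a x y Ax Ay j _]; first exact: submod0.
  by apply: submodD (Ay _ _) => //; apply: submodZ (Ax _ _).
have FT : F (size qs) = setT.
  apply/seteqP; split=> // x _ j _.
  by rewrite /A /c take_size cnt power_residual_setT.
have F0 : ~ (setT `<=` F 0%N).
  move=> FT0; pose i := Ordinal hn.
  apply: (@power_residual_proper _ _ hR hM _ _ (p_prime i) 0 (nsupp i)) => //.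
  by apply/seteqP; split=> // x _; have := FT0 x I i I; rewrite /A /c take0.
exists (F 0%N); split=> //; exists qs; split=> //.
exists F; split=> // t ts.
have /flattenP[_ /mapP[i _ ->]] : nth setT qs t \in qs by apply: mem_nth.
rewrite mem_nseq => /andP[_ /eqP ti]; rewrite ti.
have cS j : c t.+1 j = (c t j + (j == i))%N.
  by rewrite /c (count_take_nth setT) // ti (inj_eq p_distinct) eq_sym.
(* Step t is itself of type [p i] and is counted only in [c t.+1 i], which is at most [r i]. *)
have cti : (c t i < r i)%N.
  rewrite -addn1; have := cS i; rewrite eqxx => <-.
  rewrite -(cnt i) -[X in (_ <= count_mem _ X)%N](cat_take_drop t.+1).
  by rewrite count_cat leq_addr.
apply: regular_prime_ext_bigcap => //.
- by move=> j u x; apply: sat_residual_cancel.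
- by rewrite /A cS eqxx addn1 power_residualS.
- by move=> j /negbTE ji; rewrite /A cS ji addn0.
- by rewrite /A cS eqxx addn1; apply: power_residual_strict.
(* With exponent 0 at i, the element b = 1 is allowed, so u itself lies in [p j] to the power [r j]
   for all j != i and maps M into those components. *)
pose k j := if j == i then 0%N else r j.
have [u pu Ju] := separating_element k i p_prime p_incomparable.
exists u => // j y ji; apply: power_residual_absorb => //.
have : ideal_exp (p j) (k j) u.
  apply: (@big_ideal_mul_sub R _ (fun j => ideal_exp (p j) (k j)) j) => //.
  by rewrite -[u]mul1r; apply: Ju; rewrite /k eqxx.
by rewrite /k (negbTE ji).
Qed.
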